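(* Let $A\in\mathbb{C}^{n\times n}$, $B\in\mathbb{C}^{m\times m}$, $C\in\mathbb{C}^{n\times b}$, $Z\in\mathbb{C}^{m\times b}$, and let $\boldsymbol{\xi}=\{\xi_0,\dots,\xi_h\}$ be a sequence of poles with $\xi_0=\xi_h=\infty$. Let $V_{h+1}\in\mathbb{C}^{n\times b(h+1)}$ be the orthonormal block basis of the block rational Krylov subspace $\mathcal{Q}_{h+1}(A,C,\boldsymbol{\xi})$, and $\underline{H}_h,\underline{K}_h\in\mathbb{C}^{b(h+1)\times bh}$ the matrices, generated by the block rational Arnoldi algorithm. Let $V_h$ be the matrix obtained from $V_{h+1}$ by removing its last $b$ columns, let $K_h$ be the leading principal $bh\times bh$ submatrix of $\underline{K}_h$, and let $e_{h+1}=[0,\dots,0,I_b]^H\in\mathbb{C}^{b(h+1)\times b}$. Suppose $Y\in\mathbb{C}^{bh\times m}$ solves $$(V_h^HAV_h)Y+YB-V_h^HCZ^H=0,$$ and set $$\rho_h=AV_hY+V_hYB-CZ^H.$$ Then $$\rho_h=V_{h+1}e_{h+1}e_{h+1}^H\underline{H}_hK_h^{-1}Y\qquad\text{and}\qquad\|\rho_h\|_F=\|e_{h+1}^H\underline{H}_hK_h^{-1}Y\|_F.$$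
   Context: $\|\cdot\|_F$ is the Frobenius norm, $M^H$ the conjugate transpose, $\Lambda(A)$ the spectrum of $A$. Block rational Krylov subspace: for poles $\boldsymbol{\xi}_k=\{\xi_0,\dots,\xi_{k-1}\}\subseteq(\mathbb{C}\cup\{\infty\})\setminus\Lambda(A)$ and $Q_k(z)=\prod_{\xi_j\in\boldsymbol{\xi}_k,\,\xi_j\neq\infty}(z-\xi_j)$, $$\mathcal{Q}_k(A,C,\boldsymbol{\xi}_k)=\Big\{Q_k(A)^{-1}\sum_{j=0}^{k-1}A^jC\,\Gamma_j:\ \Gamma_j\in\mathbb{C}^{b\times b}\Big\}.$$ Standing assumption: these spaces are strictly nested in $k$ and of full block dimension $kb$. An orthonormal block basis of $\mathcal{Q}_k(A,C,\boldsymbol{\xi}_k)$ is a matrix $[v_1,\dots,v_k]\in\mathbb{C}^{n\times bk}$ with orthonormal columns, whose $n\times b$ blocks lie in the space and such that every element of the space has the form $\sum_jv_j\Gamma_j$ with $\Gamma_j\in\mathbb{C}^{b\times b}$. Block rational Arnoldi algorithm (poles nonzero, convention $A/\infty=0$). Let $v_1$ be the orthonormal factor of the thin QR decomposition of $(I-A/\xi_0)^{-1}C$. For $j=1,\dots,h$: set $w=(I-A/\xi_j)^{-1}Av_j$; for $i=1,\dots,j$ set the $b\times b$ block $(i,j)$ of $\underline{H}_h$ equal to $v_i^Hw$ and replace $w$ by $w-v_i(\underline{H}_h)_{i,j}$; compute the thin QR decomposition $w=v_{j+1}(\underline{H}_h)_{j+1,j}$; the remaining blocks of the $j$th block column of $\underline{H}_h$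 are zero. The $j$th block column of $\underline{K}_h$ is the $j$th block column of $\underline{H}_h$ divided by $\xi_j$ (zero if $\xi_j=\infty$), plus $[0,\dots,0,I_b,0,\dots,0]^T$ with $I_b$ in block position $j$. The algorithm is assumed to run without breakdown, i.e. all the triangular factors in the QR decompositions are nonsingular. Then $V_{h+1}=[v_1,\dots,v_{h+1}]$ is an orthonormal block basis of $\mathcal{Q}_{h+1}(A,C,\{\xi_0,\dots,\xi_h\})$, the matrices $\underline{H}_h,\underline{K}_h$ are block upper Hessenberg, and $$AV_{h+1}\underline{K}_h=V_{h+1}\underline{H}_h.$$ *)

(* Defs.v *)
From mathcomp Require Import all_boot all_order all_algebra.
From mathcomp Require Import sesquilinear spectral.

Set Implicit Arguments.
Unset Strict Implicit.
Unset Printing Implicit Defensive.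

Import Order.TTheory GRing.Theory Num.Theory.
Local Open Scope ring_scope.
Local Open Scope sesquilinear_scope.

(* k * b, in the form expected by \mxrow, \mxcol and \mxblock for k blocks of
   the same size b. *)
Notation bdim k b := (\sum_(_ < k) b)%N.

Section BlockRationalKrylov.
Variable F : numClosedFieldType.

Definition frob p q (M : 'M[F]_(p, q)) : F :=
  sqrtC (\sum_i \sum_j `|M i j| ^+ 2).

(* Extended complex numbers: None is the point at infinity. *)
Definition pole := option F.

(* 1 / xi, with 1 / oo = 0. *)
Definition pole_inv (xi : pole) : F := if xi is Some z then z^-1 else 0.

(* The factor A - xi I contributed by xi to Q_k(A); infinite poles are
   skipped. *)
Definition pole_factor n (A : 'M[F]_n) (xi : pole) : 'M[F]_n :=
  if xi is Some z then A - z%:M else 1%:M.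

Section Space.
Variables (n b N : nat) (A : 'M[F]_n) (C : 'M[F]_(n, b)).
Variable xi : 'I_N -> pole.

(* Only the first k poles are used, for k <= N. *)
Definition Qmx (k : nat) : 'M[F]_n := \prod_(j < N | (j < k)%N) pole_factor A (xi j).

Definition in_brk (k : nat) (M : 'M[F]_(n, b)) : Prop :=
  exists G : 'I_k -> 'M[F]_b,
    M = invmx (Qmx k) *m \sum_(j < k) (A ^+ j *m C *m G j).

(* Its column space is the sum of the column spaces of the elements of the
   k-th space. *)
Definition brk_gen (k : nat) : 'M[F]_(n, bdim k b) :=
  \mxrow_(j < k) (invmx (Qmx k) *m A ^+ j *m C).

Definition brk_full_dim (k : nat) : Prop := \rank (brk_gen k) = (k * b)%N.

Definition brk_strictly_nested (k : nat) : Prop :=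
  (forall M, in_brk k M -> in_brk k.+1 M) /\
  exists2 M, in_brk k.+1 M & ~ in_brk k M.

Definition orthonormal_block_basis (k : nat) (V : 'M[F]_(n, bdim k b)) : Prop :=
  [/\ V^t* *m V = 1%:M,
      forall j : 'I_k, in_brk k (submxrow V j)
    & forall M, in_brk k M ->
        exists G : 'I_k -> 'M[F]_b, M = \sum_(j < k) submxrow V j *m G j].

End Space.

Definition admissible_poles n N (A : 'M[F]_n) (xi : 'I_N -> pole) : Prop :=
  forall j z, xi j = Some z -> z != 0 /\ ~~ eigenvalue A z.

(* is_trig_mx means lower triangular. *)
Definition thin_qr n b (W Q : 'M[F]_(n, b)) (T : 'M[F]_b) : Prop :=
  [/\ Q^t* *m Q = 1%:M, is_trig_mx T^T & W = Q *m T].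

(* Blocks are numbered from 0: block j of V is v_(j+1), and the step that
   produces it from block j of V uses the pole of index j + 1. *)
Definition step_pole h (xi : 'I_h.+1 -> pole) (j : 'I_h) : pole := xi (lift ord0 j).

(* (V, H, K) is the output of a run without breakdown.  The function w lists
   the successive values of the variable w during step j (modified
   Gram-Schmidt). *)
Record block_rational_arnoldi n b h (A : 'M[F]_n) (C : 'M[F]_(n, b))
    (xi : 'I_h.+1 -> pole) (V : 'M[F]_(n, bdim h.+1 b))
    (H K : 'M[F]_(bdim h.+1 b, bdim h b)) : Prop := BlockRationalArnoldi {
  arnoldi_start : exists2 T : 'M[F]_b,
    thin_qr (invmx (1%:M - pole_inv (xi ord0) *: A) *m C) (submxrow V ord0) T
    & T \in unitmx;
  arnoldi_orth : forall j : 'I_h, exists w : nat -> 'M[F]_(n, b),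
    [/\ w 0%N = invmx (1%:M - pole_inv (step_pole xi j) *: A) *m A
                  *m submxrow V (widen_ord (leqnSn h) j),
        forall i : 'I_h.+1, (i <= j)%N ->
          submxblock H i j = (submxrow V i)^t* *m w i /\
          w i.+1 = w i - submxrow V i *m submxblock H i j
      & thin_qr (w j.+1) (submxrow V (lift ord0 j))
          (submxblock H (lift ord0 j) j)];
  arnoldi_no_breakdown : forall j : 'I_h, submxblock H (lift ord0 j) j \in unitmx;
  arnoldi_hessenberg : forall (i : 'I_h.+1) (j : 'I_h), (j.+1 < i)%N ->
    submxblock H i j = 0;
  arnoldi_K : forall (i : 'I_h.+1) (j : 'I_h),
    submxblock K i j =
      pole_inv (step_pole xi j) *: submxblock H i j
      + (if i == j :> nat then 1%:M else 0) }.

Definition drop_last_block n b h (V : 'M[F]_(n, bdim h.+1 b)) : 'M[F]_(n, bdim h b) :=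
  \mxrow_(j < h) submxrow V (widen_ord (leqnSn h) j).

Definition leading_block_mx b h (K : 'M[F]_(bdim h.+1 b, bdim h b)) :
    'M[F]_(bdim h b) :=
  \mxblock_(i < h, j < h) submxblock K (widen_ord (leqnSn h) i) j.

Definition last_block_unit b h : 'M[F]_(bdim h.+1 b, b) :=
  \mxcol_(i < h.+1) ((if i == ord_max then 1%:M else 0) : 'M[F]_b).

End BlockRationalKrylov.

Arguments last_block_unit {F} b h.

(* Main.v *)
(** Solving the recursion for the columns of [H] and [K] gives [A V K = V H].
    Since the last pole is infinite, the last block row of [K] vanishes, so
    [A V_h K_h = V H].  The subdiagonal blocks of the block Hessenberg matrix
    [H] are invertible, so [H], hence [V H], has trivial kernel, and [K_h] is
    invertible.  Since the first pole is infinite, the columns of [C] lie in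
    the span of [V_h].  If [P] is the orthogonal projection onto the complement
    of that span, the projected equation thus says that [rho] is
    [P A V_h Y = P V H K_h^-1 Y], and [P V] is [V e] times the adjoint of [e].
    The norm identity holds because [V e] has orthonormal columns. *)

Require Import Defs.
From mathcomp Require Import all_boot all_order all_algebra.
From mathcomp Require Import sesquilinear spectral complex reals.

Set Implicit Arguments.
Unset Strict Implicit.
Unset Printing Implicit Defensive.

Import Order.TTheory GRing.Theory Num.Theory.
Local Open Scope ring_scope.
Local Open Scope complex_scope.
Local Open Scope sesquilinear_scope.

Section BlockUnits.
Variable F : numClosedFieldType.

(** At [ord_max] this is convertible to [last_block_unit], so the lemmas below also apply to the
    latter. *)
Definition block_unit k b (i : 'I_k) : 'M[F]_(bdim k b, b) :=
  \mxcol_(l < k) ((if l == i then 1%:M else 0) : 'M[F]_b).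

(** The identity without its last [b] columns. It turns both truncations, of [V] and of [K], into
    matrix products. *)
Definition leading_blocks b h : 'M[F]_(bdim h.+1 b, bdim h b) :=
  \mxrow_(j < h) block_unit b (widen_ord (leqnSn h) j).

Lemma mulmx_block_unit n k b (V : 'M[F]_(n, bdim k b)) i :
  V *m block_unit b i = submxrow V i.
Proof.
rewrite -{1}[V]submxrowK mul_mxrow_mxcol (bigD1 i) //= eqxx mulmx1 big1 ?addr0 //.
by move=> l /negPf ->; rewrite mulmx0.
Qed.

Lemma block_unit_adj k b (i : 'I_k) :
  (block_unit b i)^t* = \mxrow_(l < k) ((if l == i then 1%:M else 0) : 'M[F]_b).
Proof.
apply/matrixP => r s; rewrite !mxE.
by case: ifP => _; rewrite !mxE ?conjC0 // eq_sym conjC_nat.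
Qed.

Lemma block_unit_adj_mulmx n k b (M : 'M[F]_(bdim k b, n)) i :
  (block_unit b i)^t* *m M = submxcol M i.
Proof.
rewrite block_unit_adj -{1}[M]submxcolK mul_mxrow_mxcol (bigD1 i) //= eqxx mul1mx.
by rewrite big1 ?addr0 // => l /negPf ->; rewrite mul0mx.
Qed.

Lemma block_unit_adjK k b (i : 'I_k) : (block_unit b i)^t* *m block_unit b i = 1%:M.
Proof. by rewrite block_unit_adj_mulmx mxcolK eqxx. Qed.

Lemma leading_blocks_adj b h : (leading_blocks b h)^t* =
  \mxcol_(j < h) (block_unit b (widen_ord (leqnSn h) j))^t*.
Proof. by rewrite tr_mxrow; apply/matrixP => r s; rewrite !mxE. Qed.

Lemma drop_last_blockE n b h (V : 'M[F]_(n, bdim h.+1 b)) :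
  drop_last_block V = V *m leading_blocks b h.
Proof. by rewrite mul_mxrow; apply/eq_mxrow => j; rewrite mulmx_block_unit. Qed.

Lemma leading_block_mxE b h (K : 'M[F]_(bdim h.+1 b, bdim h b)) :
  leading_block_mx K = (leading_blocks b h)^t* *m K.
Proof.
rewrite leading_blocks_adj mxcol_mul /leading_block_mx mxblockEv.
apply/eq_mxcol => i; rewrite block_unit_adj_mulmx -[RHS]submxrowK.
by apply/eq_mxrow => j; rewrite submxblockEv.
Qed.

Lemma block_unit_resolution k b :
  \sum_(i < k) block_unit b i *m (block_unit b i)^t* = 1%:M.
Proof.
rewrite -mul_mxrow_mxcol.
have -> : \mxrow_(i < k) block_unit b i = 1%:M.
  by apply/mxrowP => i; rewrite mxrowK -mulmx_block_unit mul1mx.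
rewrite mul1mx; apply/mxcolP => i.
by rewrite mxcolK -[LHS]mulmx1 block_unit_adj_mulmx.
Qed.

Lemma leading_last_resolution b h :
  leading_blocks b h *m (leading_blocks b h)^t*
    + last_block_unit b h *m (last_block_unit b h)^t* = 1%:M.
Proof.
rewrite leading_blocks_adj mul_mxrow_mxcol -block_unit_resolution [RHS]big_ord_recr /=.
by congr (_ + _).
Qed.

(** The squared norm of [N] is the trace of [N^t* *m N], where the factor [U^t* *m U] cancels. *)
Lemma frob_isometry n p q (U : 'M[F]_(n, p)) (M : 'M[F]_(p, q)) :
  U^t* *m U = 1%:M -> frob (U *m M) = frob M.
Proof.
move=> UU; have trE r (N : 'M[F]_(r, q)) :
    \sum_i \sum_j `|N i j| ^+ 2 = \tr (N^t* *m N).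
  rewrite exchange_big /=; apply: eq_bigr => j _; rewrite mxE.
  by apply: eq_bigr => i _; rewrite !mxE normCK mulrC.
by rewrite /frob !trE trmx_mul map_mxM -!mulmxA (mulmxA _ U) UU mul1mx.
Qed.

Lemma unitmx_of_mulmx_inj n (M : 'M[F]_n) :
  (forall p (X : 'M[F]_(n, p)), M *m X = 0 -> X = 0) -> M \in unitmx.
Proof.
(* [M] annihilates its own cokernel matrix, which is therefore zero. *)
by move=> Minj; rewrite -row_full_unit -cokermx_eq0; apply/eqP/Minj/mulmx_coker.
Qed.

(** Back substitution from the last block of [X]: in block row [j + 1] of [H *m X], the terms left
    of column [j] vanish by the Hessenberg shape, those right of it by induction, and the remaining
    coefficient is invertible. *)
Lemma hessenberg_inj b h p (H : 'M[F]_(bdim h.+1 b, bdim h b))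
    (X : 'M[F]_(bdim h b, p)) :
    (forall (i : 'I_h.+1) (j : 'I_h), (j.+1 < i)%N -> submxblock H i j = 0) ->
    (forall j : 'I_h, submxblock H (lift ord0 j) j \in unitmx) ->
  H *m X = 0 -> X = 0.
Proof.
move=> Hhess Hunit HX0.
suff X0 t (j : 'I_h) : (h - j <= t)%N -> submxcol X j = 0.
  by apply/mxcolP => j; rewrite submxcol0 (X0 h) ?leq_subr.
elim: t j => [|t IHt] j; first by rewrite leqn0 subn_eq0 leqNgt ltn_ord.
move=> le_hj.
have : submxcol (H *m X) (lift ord0 j) = 0 by rewrite HX0 submxcol0.
rewrite -submxcol_mul -[submxcol H _]submxrowK -{1}[X]submxcolK mul_mxrow_mxcol.
rewrite (bigD1 j) //= [X in _ + X = _]big1 => [|l ne_lj].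
  by rewrite -submxblockEv addr0 => /(canRL (mulKmx (Hunit j))); rewrite mulmx0.
have [lt_lj | lt_jl | /val_inj eq_lj] := ltngtP l j.
- by rewrite -submxblockEv Hhess ?mul0mx // lift0 ltnS.
- rewrite IHt ?mulmx0 // -ltnS (leq_trans _ le_hj) // ltn_sub2l //.
- by rewrite eq_lj eqxx in ne_lj.
Qed.

End BlockUnits.

Section Arnoldi.
Context (F : numClosedFieldType) (n b h : nat) (A : 'M[F]_n) (C : 'M[F]_(n, b))
  (xi : 'I_h.+1 -> pole F) (V : 'M[F]_(n, bdim h.+1 b))
  (H K : 'M[F]_(bdim h.+1 b, bdim h b)) (xi_ok : admissible_poles A xi)
  (arnoldi : block_rational_arnoldi A C xi V H K).

Lemma pole_shift_unit j : 1%:M - pole_inv (xi j) *: A \in unitmx.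
Proof.
case xi_j: (xi j) => [z|] /=; last by rewrite scale0r subr0 unitmx1.
(* A nonzero row vector in the kernel of [1 - z^-1 A] would be a left eigenvector of [A] for [z]. *)
have [z_neq0 notAz] := xi_ok xi_j.
rewrite -row_free_unit -kermx_eq0; apply: contraR notAz => /rowV0Pn[v].
rewrite sub_kermx mulmxBr mulmx1 -scalemxAr subr_eq0 => /eqP v_eq v_neq0.
by apply/eigenvalueP; exists v => //; rewrite {2}v_eq scalerA divff ?scale1r.
Qed.

Lemma arnoldi_step (j : 'I_h) :
  (1%:M - pole_inv (step_pole xi j) *: A) *m (V *m submxrow H j) =
  A *m submxrow V (widen_ord (leqnSn h) j).
Proof.
have [w [w0 wS [_ _ w_last]]] := arnoldi_orth arnoldi j.
suff -> : V *m submxrow H j = w 0%N by rewrite w0 -mulmxA mulKVmx ?pole_shift_unit.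
(* Loop invariant of Gram-Schmidt: the components removed so far plus the current remainder give
   back the initial vector block. *)
have w0E t : (t <= j.+1)%N -> w 0%N =
    \sum_(i < h.+1 | (i < t)%N) submxrow V i *m submxblock H i j + w t.
  elim: t => [_|t IHt lt_tj]; first by rewrite big_pred0 ?add0r.
  have lt_th : (t < h.+1)%N by rewrite (leq_trans lt_tj) // ltnW // ltnS.
  have /= [_ wt] := wS (Ordinal lt_th) lt_tj.
  rewrite (bigD1 (Ordinal lt_th)) //= wt (IHt (ltnW lt_tj)).
  rewrite [RHS]addrC addrA subrK [LHS]addrC.
  congr (_ + _); apply: eq_bigl => i.
  by rewrite -val_eqE /= ltnS [in RHS]leq_eqVlt; case: ltngtP.
(* Rows up to [j] come from the orthogonalization, row [j + 1] from the QR factorization, and lower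
   rows are zero. *)
rewrite (w0E j.+1) // w_last -[V in LHS]submxrowK -[submxrow H j]submxcolK.
rewrite mul_mxrow_mxcol (bigID (fun i : 'I_h.+1 => (i < j.+1)%N)) /=.
congr (_ + _); first by apply: eq_bigr => i _; rewrite submxblockEh.
rewrite (bigD1 (lift ord0 j)) ?lift0 ?ltnn //= [X in _ + X]big1 ?addr0.
  by rewrite submxblockEh.
move=> i /andP[le_ji ne_ij].
rewrite -submxblockEh (arnoldi_hessenberg arnoldi) ?mulmx0 //.
by rewrite ltn_neqAle [(j < i)%N]leqNgt le_ji andbT -lift0 eq_sym val_eqE.
Qed.

Lemma submxrow_arnoldi_K (j : 'I_h) :
  submxrow K j = pole_inv (step_pole xi j) *: submxrow H j
                 + block_unit F b (widen_ord (leqnSn h) j).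
Proof.
apply/mxcolP => i; rewrite submxcolD mxcolK -submxblockEh (arnoldi_K arnoldi).
by congr (_ + _); apply/matrixP => r s; rewrite !mxE.
Qed.

(** In each block column, the pole term in [K] cancels the one in [arnoldi_step]. *)
Lemma rational_arnoldi_relation : A *m V *m K = V *m H.
Proof.
apply/mxrowP => j; rewrite -!mul_submxrow submxrow_arnoldi_K mulmxDr -!mulmxA.
rewrite mulmx_block_unit -arnoldi_step mulmxBl mul1mx -!scalemxAl -!scalemxAr.
by rewrite addrC subrK.
Qed.

(** The identity blocks of [K] stop above the last row. In that row [H] can be nonzero only in its
    last block column, where it is scaled by the inverse of the infinite last pole. *)
Lemma last_block_row_K : xi ord_max = None -> (last_block_unit b h)^t* *m K = 0.
Proof.
move=> xi_max; rewrite (block_unit_adj_mulmx K ord_max).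
apply/mxrowP => j; rewrite submxrow0 -submxblockEv (arnoldi_K arnoldi) /=.
rewrite [h == j](gtn_eqF (ltn_ord j)) addr0.
have [lt_jh | le_hj] := ltnP j.+1 h.
  by rewrite (arnoldi_hessenberg arnoldi) ?scaler0.
suff -> : step_pole xi j = None by rewrite scale0r.
rewrite -xi_max /step_pole; congr xi; apply/val_inj => /=.
by apply/eqP; rewrite eqn_leq le_hj ltn_ord.
Qed.

Lemma leading_arnoldi_relation : xi ord_max = None ->
  A *m drop_last_block V *m leading_block_mx K = V *m H.
Proof.
move=> xi_max; rewrite -rational_arnoldi_relation drop_last_blockE leading_block_mxE.
rewrite -[K in RHS]mul1mx -leading_last_resolution mulmxDl -[_ *m _ *m K in RHS]mulmxA.
rewrite -[last_block_unit _ _ *m _ *m _]mulmxA.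
by rewrite last_block_row_K // mulmx0 addr0 !mulmxA.
Qed.

Lemma leading_block_K_unit : xi ord_max = None -> V^t* *m V = 1%:M ->
  leading_block_mx K \in unitmx.
Proof.
move=> xi_max VV; apply: unitmx_of_mulmx_inj => p X KX0.
apply: (hessenberg_inj (arnoldi_hessenberg arnoldi) (arnoldi_no_breakdown arnoldi)).
rewrite -[H]mul1mx -VV -[_ *m V *m H]mulmxA -leading_arnoldi_relation // -!mulmxA.
by rewrite KX0 !mulmx0.
Qed.

End Arnoldi.

Theorem lemma5p1 (R : realType) (n m b h : nat)
    (A : 'M[R[i]]_n) (B : 'M[R[i]]_m) (C : 'M[R[i]]_(n, b)) (Z : 'M[R[i]]_(m, b))
    (xi : 'I_h.+1 -> pole R[i])
    (V : 'M[R[i]]_(n, bdim h.+1 b)) (H K : 'M[R[i]]_(bdim h.+1 b, bdim h b))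
    (Y : 'M[R[i]]_(bdim h b, m))
    (h_gt0 : (0 < h)%N)
    (xi_ok : admissible_poles A xi)
    (xi_first : xi ord0 = None)
    (xi_last : xi ord_max = None)
    (full_dim : forall k, (0 < k <= h.+1)%N -> brk_full_dim A C xi k)
    (nested : forall k, (0 < k <= h)%N -> brk_strictly_nested A C xi k)
    (arnoldi : block_rational_arnoldi A C xi V H K)
    (basis : orthonormal_block_basis A C xi V)
    (Y_sol : let Vh := drop_last_block V in
      (Vh^t* *m A *m Vh) *m Y + Y *m B - Vh^t* *m C *m Z^t* = 0) :
  let Vh := drop_last_block V in
  let Kh := leading_block_mx K in
  let e := last_block_unit b h in
  let rho := A *m Vh *m Y + Vh *m Y *m B - C *m Z^t* in
  [/\ Kh \in unitmx,
      rho = V *m e *m e^t* *m H *m invmx Kh *m Y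
    & frob rho = frob (e^t* *m H *m invmx Kh *m Y)].
Proof.
move=> Vh Kh e rho.
have [VV _ _] := basis.
have Kh_unit : Kh \in unitmx by apply: leading_block_K_unit arnoldi _ VV.
have AVh : A *m Vh = V *m H *m invmx Kh.
  by rewrite -(leading_arnoldi_relation xi_ok arnoldi xi_last) mulmxK.
set E := leading_blocks R[i] b h.
have VhE : Vh = V *m E by rewrite /Vh drop_last_blockE.
have VhVh : Vh *m Vh^t* = V *m E *m E^t* *m V^t*.
  by rewrite VhE trmx_mul map_mxM !mulmxA.
have EE : E *m E^t* = 1%:M - e *m e^t*.
  by rewrite -(leading_last_resolution R[i] b h) addrK.
have projC : Vh *m (Vh^t* *m C) = C.
  have [T [_ _]] := arnoldi_start arnoldi.
  rewrite xi_first /= scale0r subr0 invmx1 mul1mx => -> _.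
  rewrite mulmxA VhVh -(mulmxA V E) EE -mulmx_block_unit -!mulmxA (mulmxA _ V) VV mul1mx.
  rewrite mulmxBl mul1mx mulmxBr -mulmxA block_unit_adj_mulmx -submxcol_mul mxcolK.
  (* Since [h > 0], the first block of [V], which spans the columns of [C], is not the dropped
     one. *)
  by rewrite -val_eqE /= (gtn_eqF h_gt0) mul0mx !mulmx0 subr0.
have rhoE : rho = V *m e *m (e^t* *m H *m invmx Kh *m Y).
  (* The projected equation, multiplied by [Vh], eliminates [B]; [projC] restores [C]. *)
  have VYB : Vh *m Y *m B = C *m Z^t* - Vh *m Vh^t* *m (A *m Vh *m Y).
    move/eqP: Y_sol; rewrite addrAC addr_eq0 => /eqP YB.
    have {}YB : Y *m B = Vh^t* *m C *m Z^t* - Vh^t* *m A *m Vh *m Y.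
      by rewrite -[Y *m B]opprK -YB opprB.
    by rewrite -mulmxA YB mulmxBr -!mulmxA (mulmxA _ C) (mulmxA Vh (_ *m C)) projC.
  (* What remains is [A *m Vh *m Y] minus its projection onto the span of [Vh]. *)
  rewrite /rho VYB addrCA addrAC subrr add0r VhVh -(mulmxA V E) EE AVh -!mulmxA.
  by rewrite (mulmxA _ V) VV mul1mx mulmxBl mul1mx mulmxBr -!mulmxA subKr.
split=> //; first by rewrite rhoE !mulmxA.
rewrite rhoE; apply: frob_isometry.
rewrite trmx_mul map_mxM -mulmxA (mulmxA _ V) VV mul1mx.
exact: block_unit_adjK.
Qed.
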